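(* Let $(V,\rhd)$ be a magma algebra over $\mathbf k$, and let $\mathsf T(V)_\rhd$ be the sub-adjacent Hopf algebra of the post-Hopf algebra $(\mathsf T(V),\cdot,\Delta_{\sqcup\!\sqcup},S,\rhd)$, with antipode $S_\rhd$. Then $$S_\rhd(x_1\cdots x_m)=(-1)^m\sum_\pi(x_{B_1}\blacktriangleright x_{b_1})\cdots(x_{B_{|\pi|-1}}\blacktriangleright x_{b_{|\pi|-1}}),\qquad\forall\,x_1,\dots,x_m\in V,$$ where the sum ranges over all partitions $\pi$ of $[m]=\{1,\dots,m\}$ into a tuple $(B_1,\dots,B_{|\pi|})$ of pairwise disjoint, possibly empty subsets with union $[m]$, such that the last one has exactly $|\pi|-1$ elements, written $B_{|\pi|}=\{b_1>\cdots>b_{|\pi|-1}\}$.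
   Context: $\mathbf k$ is an algebraically closed field of characteristic $0$. A magma algebra $(V,\rhd)$ is a vector space with a bilinear product $\rhd:V\otimes V\to V$. $\mathsf T(V)$ is the tensor algebra; elements of $V$ are called letters, pure tensors are written as words $x_1\cdots x_m$ (tensor signs omitted), and $|X|$ is the number of letters of a word $X$. $\mathsf T(V)$ carries the concatenation product, the coshuffle coproduct $\Delta_{\sqcup\!\sqcup}$ (the algebra map with $\Delta_{\sqcup\!\sqcup}(x)=x\otimes1+1\otimes x$ for $x\in V$; Sweedler notation $X_1\otimes X_2$, iterated coproduct $\Delta_{\sqcup\!\sqcup}^{(m-1)}(X)=X_1\otimes\cdots\otimes X_m$), its counit $\varepsilon$, and the antipode $S(x_1\cdots x_m)=(-1)^mx_m\cdots x_1$. For $I=\{i_1<\cdots<i_r\}\subseteq[m]$, $x_I=x_{i_1}\cdots x_{i_r}$ and $x_\emptyset=1$. The product $\rhd$ is extended to $\mathsf T(V)$ by: $1\rhd a=a$; $(xx_1\cdots x_n)\rhd a=x\rhd\big((x_1\cdots x_n)\rhd a\big)-\sum_{i=1}^n\big(x_1\cdots x_{i-1}(x\rhd x_i)x_{i+1}\cdots x_n\big)\rhd a$; $X\rhd1=\varepsilon(X)1$; $X\rhd(a_1\cdots a_k)=(X_1\rhd a_1)\cdots(X_k\rhd a_k)$, for $x,x_i,a,a_i\in V$, $X\in\mathsf T(V)$. This makes $\mathsf T(V)$ a cocommutative post-Hopf algebra, and its sub-adjacent Hopf algebra is $\mathsf T(V)_\rhd=(\mathsf T(V),\circ,1,\Delta_{\sqcup\!\sqcup},\varepsilon,S_\rhd)$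 with product $X\circ Y=X_1\,(X_2\rhd Y)$ and antipode denoted $S_\rhd$ (known to be a Hopf algebra). The bilinear product $\blacktriangleright$ on $\mathsf T(V)$ is defined by $X\blacktriangleright Y:=(-1)^{|X|}S_\rhd(X)\rhd Y$ for words $X,Y$. *)

(* Defs.v *)
From HB Require Import structures.
From mathcomp Require Import all_boot all_order all_algebra.
From mathcomp Require Import ring_quotient sesquilinear finmap boolp.
From mathcomp.multinomials Require Import monalg.

Set Implicit Arguments.
Unset Strict Implicit.
Unset Printing Implicit Defensive.

Import GRing.Theory.
Local Open Scope ring_scope.
Local Open Scope quotient_scope.

Section FreeExtension.
Variables (k : fieldType) (S : choiceType) (W : lmodType k) (f : S -> W).

Definition free_ext (g : {malg k[S]}) : W := \sum_(s <- msupp g) g@_s *: f s.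

Lemma free_extEw (d : {fset S}) g : {subset msupp g <= d} ->
  free_ext g = \sum_(s <- d) g@_s *: f s.
Proof.
move=> sub; move/fsubsetP: sub => sub; rewrite /free_ext (big_fset_incl _ sub) //.
by move=> s _ /mcoeff_outdom ->; rewrite scale0r.
Qed.

Lemma free_ext_linear : linear free_ext.
Proof.
move=> a g h.
pose d := (msupp (a *: g + h) `|` (msupp g `|` msupp h))%fset.
rewrite !(@free_extEw d); try by move=> s ss; rewrite !in_fsetE ss ?orbT.
rewrite scaler_sumr -big_split /=; apply: eq_bigr => s _.
by rewrite mcoeffD mcoeffZ scalerDl scalerA.
Qed.
HB.instance Definition _ :=
  GRing.isLinear.Build k {malg k[S]} W *:%R free_ext free_ext_linear.

Lemma free_extU s : free_ext << s >> = f s.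
Proof.
rewrite (@free_extEw [fset s]%fset); last exact/fsubsetP/msuppU_le.
by rewrite big_seq_fset1 mcoeffU eqxx scale1r.
Qed.

End FreeExtension.

(* [presentation rel] is a k-module with generators S and relations
   s = a t + u for all (a, s, t, u) satisfying [rel], with its universal
   property. The value of [pres_ext f] matters only for compatible f. *)
Section Presentation.
Variables (k : fieldType) (S : choiceType) (rel : k -> S -> S -> S -> Prop).

Definition compatible (W : lmodType k) (f : S -> W) :=
  forall a s t u, rel a s t u -> f s = a *: f t + f u.

Record presentation := Presentation {
  pres_mod : lmodType k;
  pres_gen : S -> pres_mod;
  pres_ext : forall W : lmodType k, (S -> W) -> pres_mod -> W;
  pres_gen_rel : compatible pres_gen;
  pres_ind : forall P : pres_mod -> Prop, P 0 ->
    (forall a x y, P x -> P y -> P (a *: x + y)) -> (forall s, P (pres_gen s)) ->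
    forall x, P x;
  pres_ext_linear : forall (W : lmodType k) (f : S -> W),
    compatible f -> linear (pres_ext f);
  pres_ext_gen : forall (W : lmodType k) (f : S -> W),
    compatible f -> forall s, pres_ext f (pres_gen s) = f s
}.

End Presentation.

(* The quotient of the free module on S by the relators. It is used only through
   the opaque [presentation_exists], since unfolding the quotient operations
   during conversion is very slow. *)
Section PresentedModule.
Variables (k : fieldType) (S : choiceType) (rel : k -> S -> S -> S -> Prop).
Local Notation F := {malg k[S]}.

Definition in_quot_span (g : F) : Prop :=
  forall P : F -> Prop, P 0 ->
    (forall a u v, P u -> P v -> P (a *: u + v)) ->
    (forall a s t u, rel a s t u -> P (<< s >> - (a *: << t >> + << u >>))) ->
    P g.

Definition quot_span : {pred F} := fun g => `[< in_quot_span g >].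

Lemma quot_spanP g : reflect (in_quot_span g) (g \in quot_span).
Proof. exact: asboolP. Qed.

Lemma quot_span_closed : submod_closed quot_span.
Proof.
split; first by apply/quot_spanP => P.
move=> a u v /quot_spanP Pu /quot_spanP Pv; apply/quot_spanP => P P0 PD Pr.
exact: PD (Pu P P0 PD Pr) (Pv P P0 PD Pr).
Qed.
HB.instance Definition _ :=
  GRing.isSubmodClosed.Build k F quot_span (GRing.submod_closed_semi quot_span_closed).

Definition quotmod := Quotient.quot quot_span.
HB.instance Definition _ := GRing.Zmodule.on quotmod.
HB.instance Definition _ := ZmodQuotient.on quotmod.

Definition quot_scale (a : k) (x : quotmod) : quotmod :=
  locked (\pi_quotmod (a *: repr x)).

Lemma quot_piZ a (g : F) : quot_scale a (\pi_quotmod g) = \pi_quotmod (a *: g).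
Proof.
rewrite /quot_scale -lock; apply/eqP; rewrite -Quotient.idealrBE -scalerBr.
by rewrite rpredZ // Quotient.idealrBE reprK.
Qed.

Fact quot_scaleA a b x : quot_scale a (quot_scale b x) = quot_scale (a * b) x.
Proof. by rewrite -[x]reprK (quot_piZ b) !quot_piZ scalerA. Qed.
Fact quot_scale1 : left_id 1 quot_scale.
Proof. by move=> x; rewrite -[x]reprK quot_piZ scale1r. Qed.
Fact quot_scaleDr : right_distributive quot_scale +%R.
Proof.
by move=> a x y; rewrite -[x]reprK -[y]reprK -raddfD !quot_piZ scalerDr raddfD.
Qed.
Fact quot_scaleDl x : {morph quot_scale^~ x : a b / a + b}.
Proof. by move=> a b; rewrite -[x]reprK !quot_piZ scalerDl raddfD. Qed.
HB.instance Definition _ := GRing.Zmodule_isLmodule.Build k quotmod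
  quot_scaleA quot_scale1 quot_scaleDr quot_scaleDl.

Definition quot_gen (s : S) : quotmod := \pi_quotmod << s >>.

Lemma quot_gen_rel : compatible rel quot_gen.
Proof.
move=> a s t u r; rewrite /quot_gen -[a *: _]/(quot_scale a _) quot_piZ -raddfD.
apply/eqP; rewrite -Quotient.idealrBE.
by apply/quot_spanP => P _ _; apply.
Qed.

Lemma quot_ind (P : quotmod -> Prop) : P 0 ->
  (forall a x y, P x -> P y -> P (a *: x + y)) -> (forall s, P (quot_gen s)) ->
  forall x, P x.
Proof.
move=> P0 PD Pg x; rewrite -[x]reprK (monalgE (repr x)) raddf_sum /=.
elim/big_ind: _ => // [u v Pu Pv|s _]; first by rewrite -[u]scale1r; apply: PD.
have -> : << (repr x)@_s *g s >> = (repr x)@_s *: << s >> :> F.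
  apply/malgP => t; rewrite mcoeffZ !mcoeffU; case: eqP => _ /=.
    by rewrite !mulr1n mulr1.
  by rewrite !mulr0n mulr0.
rewrite -quot_piZ -[quot_scale _ _]addr0.
exact: (PD (repr x)@_s (quot_gen s) 0 (Pg s) P0).
Qed.

Lemma quot_ext_pi (W : lmodType k) (f : S -> W) (g : F) : compatible rel f ->
  free_ext f (repr (\pi_quotmod g)) = free_ext f g.
Proof.
move=> fP; apply/eqP; rewrite -subr_eq0 -raddfB /=.
have /quot_spanP H : repr (\pi_quotmod g) - g \in quot_span.
  by rewrite Quotient.idealrBE reprK.
apply/eqP; apply: (H (fun h => free_ext f h = 0)); first exact: linear0.
  by move=> a u v fu fv; rewrite linearP /= fu fv scaler0 addr0.
move=> a s t u /fP E.
by rewrite linearB linearP /= !free_extU E subrr.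
Qed.

Lemma presentation_exists : presentation rel.
Proof.
apply: (@Presentation k S rel quotmod quot_gen
  (fun W f x => free_ext f (repr x)) quot_gen_rel quot_ind) => W f fP.
  move=> a x y; rewrite -[x]reprK -[y]reprK -[a *: _]/(quot_scale a _) quot_piZ.
  by rewrite -raddfD !quot_ext_pi // linearP.
by move=> s; rewrite quot_ext_pi // free_extU.
Qed.

Definition presmod : lmodType k := pres_mod presentation_exists.
Definition gen : S -> presmod := @pres_gen _ _ _ presentation_exists.
Definition gen_ext (W : lmodType k) (f : S -> W) : presmod -> W :=
  @pres_ext _ _ _ presentation_exists W f.

End PresentedModule.

Section TensorProduct.
Variables (k : fieldType) (U W : lmodType k).

Inductive bilin_rel : k -> U * W -> U * W -> U * W -> Prop :=
  | bilin_rel_l a u v w : bilin_rel a (a *: u + v, w) (u, w) (v, w)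
  | bilin_rel_r a u w z : bilin_rel a (u, a *: w + z) (u, w) (u, z).

Definition tprod : Type := presmod bilin_rel.
HB.instance Definition _ := GRing.Lmodule.on tprod.

Definition tens (u : U) (w : W) : tprod := gen bilin_rel (u, w).

Lemma tens_bilinear : bilinear_for *:%R *:%R tens.
Proof. by split=> [w a u v|u a w z]; apply: pres_gen_rel; constructor. Qed.
HB.instance Definition _ := bilinear_isBilinear.Build k U W tprod
  *:%R *:%R tens tens_bilinear.

Lemma tprod_ind (P : tprod -> Prop) :
  (forall a x y, P x -> P y -> P (a *: x + y)) -> (forall u w, P (tens u w)) ->
  forall x, P x.
Proof.
move=> PD Pt; apply: pres_ind => // [|[u w]]; last exact: Pt.
by rewrite -[0](addNr (tens 0 0)) -scaleN1r; apply: PD.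
Qed.

Variables (X : lmodType k) (f : U -> W -> X).

(* The linear map induced by f; meaningful when f is bilinear. *)
Definition tens_ext : tprod -> X := @gen_ext k _ bilin_rel X (fun p => f p.1 p.2).

Hypothesis f_bilinear : bilinear_for *:%R *:%R f.

Let f_compatible : compatible bilin_rel (fun p => f p.1 p.2).
Proof.
case: f_bilinear => fl fr _ _ _ _ [a u v w|a u w z] /=; first exact: fl.
exact: fr.
Qed.

Lemma tens_ext_tens u w : tens_ext (tens u w) = f u w.
Proof. exact: (@pres_ext_gen _ _ _ _ _ _ f_compatible). Qed.

Lemma tens_ext_linear : linear tens_ext.
Proof. exact: (@pres_ext_linear _ _ _ _ _ _ f_compatible). Qed.

End TensorProduct.

Notation "U \ox W" := (tprod U W) (at level 40, left associativity) : type_scope.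
Notation "u \ox w" := (tens u w) : ring_scope.

Section TensorAlgebra.
Variables (k : fieldType) (V : lmodType k).

(* Words are multilinear in their letters; no relation links words of
   different lengths, so this presents the direct sum of the tensor powers. *)
Inductive word_rel : k -> seq V -> seq V -> seq V -> Prop :=
  WordRel a p x y q :
    word_rel a (p ++ (a *: x + y) :: q) (p ++ x :: q) (p ++ y :: q).

Definition tensalg : Type := presmod word_rel.
HB.instance Definition _ := GRing.Lmodule.on tensalg.

Definition word (w : seq V) : tensalg := gen word_rel w.

Definition multilinear (W : lmodType k) (f : seq V -> W) := forall a p x y q,
  f (p ++ (a *: x + y) :: q) = a *: f (p ++ x :: q) + f (p ++ y :: q).

Lemma word_multilinear : multilinear word.
Proof. by move=> a p x y q; apply: pres_gen_rel; constructor. Qed.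

Lemma tensalg_ind (P : tensalg -> Prop) :
  (forall a X Y, P X -> P Y -> P (a *: X + Y)) -> (forall w, P (word w)) ->
  forall X, P X.
Proof.
move=> PD Pw; apply: pres_ind => //.
by rewrite -[0](addNr (word [::])) -scaleN1r; apply: PD.
Qed.

Section Ext.
Variables (W : lmodType k) (f : seq V -> W).

(* The linear map given by f on words; meaningful when f is multilinear. *)
Definition word_ext : tensalg -> W := @gen_ext k _ word_rel W f.

Hypothesis fM : multilinear f.

Let f_compatible : compatible word_rel f.
Proof. by move=> _ _ _ _ [a p x y q]; apply: fM. Qed.

Lemma word_ext_word w : word_ext (word w) = f w.
Proof. exact: (@pres_ext_gen _ _ _ _ _ _ f_compatible). Qed.

Lemma word_ext_linear : linear word_ext.
Proof. exact: (@pres_ext_linear _ _ _ _ _ _ f_compatible). Qed.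

End Ext.

Lemma tensalg_eq (W : lmodType k) (f g : tensalg -> W) : linear f -> linear g ->
  (forall w, f (word w) = g (word w)) -> f =1 g.
Proof.
move=> fl gl fg; apply: tensalg_ind => // a X Y fX fY.
by rewrite fl gl fX fY.
Qed.

Lemma word_cat_linear w : linear (word_ext (fun v => word (w ++ v))).
Proof.
by apply: word_ext_linear => a p x y q; rewrite !catA word_multilinear.
Qed.

Lemma word_cat_word w v : word_ext (fun v => word (w ++ v)) (word v) = word (w ++ v).
Proof.
by apply: word_ext_word => a p x y q; rewrite !catA word_multilinear.
Qed.

Definition tmul (X Y : tensalg) : tensalg :=
  word_ext (fun u => word_ext (fun v => word (u ++ v)) Y) X.

Lemma tmul_multilinear Y :
  multilinear (fun u => word_ext (fun v => word (u ++ v)) Y).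
Proof.
move=> a p x y q; elim/tensalg_ind: Y => [b Y Z IY IZ|w].
  rewrite !(word_cat_linear _ b Y Z) IY IZ !scalerDr !scalerA (mulrC b a).
  exact: addrACA.
by rewrite !word_cat_word -!catA /= word_multilinear.
Qed.

Lemma tmul_word u v : tmul (word u) (word v) = word (u ++ v).
Proof. by rewrite /tmul (word_ext_word (tmul_multilinear _)) word_cat_word. Qed.

Lemma tmul_linearl Y : linear (tmul^~ Y).
Proof. exact/word_ext_linear/tmul_multilinear. Qed.

Lemma tmul_linearr X : linear (tmul X).
Proof.
elim/tensalg_ind: X => [a X Y IX IY b Z T|u].
  rewrite !tmul_linearl IX IY !scalerDr !scalerA (mulrC b a).
  exact: addrACA.
move=> b Z T; rewrite /tmul !(word_ext_word (tmul_multilinear _)).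
exact: word_cat_linear.
Qed.

Fact tmulA : associative tmul.
Proof.
move=> X Y Z; elim/tensalg_ind: X => [a X X' IX IX'|u].
  by rewrite !tmul_linearl IX IX'.
elim/tensalg_ind: Y => [a Y Y' IY IY'|v].
  by rewrite tmul_linearr !tmul_linearl tmul_linearr IY IY'.
elim/tensalg_ind: Z => [a Z Z' IZ IZ'|w].
  by rewrite !tmul_linearr IZ IZ'.
by rewrite !tmul_word catA.
Qed.

Fact tmul1X : left_id (word [::]) tmul.
Proof.
elim/tensalg_ind => [a X Y IX IY|w]; last by rewrite tmul_word.
by rewrite tmul_linearr IX IY.
Qed.

Fact tmulX1 : right_id (word [::]) tmul.
Proof.
elim/tensalg_ind => [a X Y IX IY|w]; last by rewrite tmul_word cats0.
by rewrite tmul_linearl IX IY.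
Qed.

Fact tmulDl : left_distributive tmul +%R.
Proof.
by move=> X Y Z; have := tmul_linearl Z 1 X Y; rewrite !scale1r.
Qed.

Fact tmulDr : right_distributive tmul +%R.
Proof.
by move=> X Y Z; have := tmul_linearr X 1 Y Z; rewrite !scale1r.
Qed.

(* Value of the counit on words: 1 on the empty word, 0 on the others. *)
Definition teps (X : tensalg) : k :=
  word_ext (W := k^o) (fun w => (nilp w)%:R) X.

Fact teps_multilinear : @multilinear k^o (fun w => (nilp w)%:R).
Proof. by move=> a [|z p] x y q; rewrite /= scaler0 addr0. Qed.

Lemma teps_word w : teps (word w) = (nilp w)%:R.
Proof. exact: (word_ext_word teps_multilinear). Qed.

Lemma teps_linear : scalar teps.
Proof. exact: (word_ext_linear teps_multilinear). Qed.
HB.instance Definition _ :=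
  GRing.isLinear.Build k tensalg k *%R teps teps_linear.

Fact tone_neq0 : word [::] != 0.
Proof.
by apply/eqP => /(congr1 teps); rewrite teps_word linear0; apply/eqP/oner_neq0.
Qed.

HB.instance Definition _ := GRing.Zmodule_isNzRing.Build tensalg
  tmulA tmul1X tmulX1 tmulDl tmulDr tone_neq0.

Fact tmulZl (a : k) (X Y : tensalg) : a *: (X * Y) = (a *: X) * Y.
Proof.
have := tmul_linearl Y a X 0; rewrite -[tmul 0 Y]/(0 * Y).
by rewrite mul0r !addr0 => /esym.
Qed.
HB.instance Definition _ := GRing.Lmodule_isLalgebra.Build k tensalg tmulZl.

Fact tmulZr (a : k) (X Y : tensalg) : a *: (X * Y) = X * (a *: Y).
Proof.
have := tmul_linearr X a Y 0; rewrite -[tmul X 0]/(X * 0).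
by rewrite mulr0 !addr0 => /esym.
Qed.
HB.instance Definition _ := GRing.Lalgebra_isAlgebra.Build k tensalg tmulZr.

Lemma wordM u v : word (u ++ v) = word u * word v.
Proof. by rewrite -tmul_word. Qed.

Lemma word0 : word [::] = 1.
Proof. by []. Qed.

Definition letter (x : V) : tensalg := word [:: x].

Lemma letter_linear : linear letter.
Proof. by move=> a x y; apply: (word_multilinear a [::]). Qed.
HB.instance Definition _ :=
  GRing.isLinear.Build k V tensalg *:%R letter letter_linear.

Lemma wordE w : word w = \prod_(x <- w) letter x.
Proof.
elim: w => [|x w IH]; first by rewrite big_nil.
by rewrite big_cons -IH -wordM.
Qed.

Fact teps_monoid_morphism : monoid_morphism teps.
Proof.
split; first by rewrite -word0 teps_word.
move=> X Y; elim/tensalg_ind: X => [a X X' IX IX'|u].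
  by rewrite mulrDl -scalerAl !teps_linear IX IX' mulrDl mulrA.
elim/tensalg_ind: Y => [a Y Y' IY IY'|v].
  by rewrite mulrDr -scalerAr !teps_linear IY IY' mulrDr mulrCA.
by rewrite -wordM !teps_word -natrM; case: u v => [|x u] [|y v].
Qed.
HB.instance Definition _ :=
  GRing.isMonoidMorphism.Build tensalg k teps teps_monoid_morphism.

(* Universal property: a linear map f from V to an algebra extends to an
   algebra map on tensalg. *)
Section AlgebraExtension.
Variables (A : algType k) (f : {linear V -> A}).

Definition alg_ext : tensalg -> A := word_ext (fun w => \prod_(x <- w) f x).

Fact alg_ext_multilinear : multilinear (fun w => \prod_(x <- w) f x).
Proof.
move=> a p x y q; rewrite !big_cat !big_cons /= linearP.
by rewrite mulrDl mulrDr -scalerAl -scalerAr.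
Qed.

Lemma alg_ext_word w : alg_ext (word w) = \prod_(x <- w) f x.
Proof. exact: word_ext_word alg_ext_multilinear _. Qed.

Lemma alg_ext_letter x : alg_ext (letter x) = f x.
Proof. by rewrite alg_ext_word big_seq1. Qed.

Fact alg_ext_linear : linear alg_ext.
Proof. exact: word_ext_linear alg_ext_multilinear. Qed.
HB.instance Definition _ :=
  GRing.isLinear.Build k tensalg A *:%R alg_ext alg_ext_linear.

Fact alg_ext_monoid_morphism : monoid_morphism alg_ext.
Proof.
split; first by rewrite -word0 alg_ext_word big_nil.
move=> X Y; elim/tensalg_ind: X => [a X X' IX IX'|u].
  by rewrite mulrDl -scalerAl !alg_ext_linear IX IX' mulrDl scalerAl.
elim/tensalg_ind: Y => [a Y Y' IY IY'|v].
  by rewrite mulrDr -scalerAr !alg_ext_linear IY IY' mulrDr scalerAr.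
by rewrite -wordM !alg_ext_word big_cat.
Qed.
HB.instance Definition _ :=
  GRing.isMonoidMorphism.Build tensalg A alg_ext alg_ext_monoid_morphism.

Lemma alg_ext_unique (g : {lrmorphism tensalg -> A}) :
  (forall x, g (letter x) = f x) -> g =1 alg_ext.
Proof.
move=> gf; apply: tensalg_eq; [exact: linearP | exact: linearP |] => w.
by rewrite alg_ext_word wordE rmorph_prod; apply: eq_bigr => x _; apply: gf.
Qed.

End AlgebraExtension.
End TensorAlgebra.

Section TensorProductAlgebra.
Variables (k : fieldType) (A B : algType k).
Implicit Types X Y Z : (A \ox B)%type.

Definition tpmul X Y : (A \ox B)%type :=
  tens_ext (fun a b => tens_ext (fun c d => (a * c) \ox (b * d)) Y) X.

Let mul_bilinear (a : A) (b : B) :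
  bilinear_for *:%R *:%R (fun c d => (a * c) \ox (b * d)).
Proof.
split=> [d e c c'|c e d d'] /=; rewrite mulrDr -scalerAr.
  exact: linearPl.
exact: linearPr.
Qed.

Let mul_linear (a : A) (b : B) : linear (tens_ext (fun c d => (a * c) \ox (b * d))).
Proof. exact/tens_ext_linear/mul_bilinear. Qed.

Let mul_tens (a : A) (b : B) (c : A) (d : B) :
  tens_ext (fun c d => (a * c) \ox (b * d)) (c \ox d) = (a * c) \ox (b * d).
Proof. exact/tens_ext_tens/mul_bilinear. Qed.

Fact tpmul_bilinear Y : bilinear_for *:%R *:%R
  (fun a b => tens_ext (fun c d => (a * c) \ox (b * d)) Y).
Proof.
split=> [b e a a'|a e b b'] /=; elim/tprod_ind: Y => [f Y Z IY IZ|c d].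
- rewrite !(mul_linear _ _ f Y Z). rewrite IY. rewrite IZ. rewrite !scalerDr. rewrite !scalerA. rewrite (mulrC e f).
  exact: addrACA.
- by rewrite !mul_tens mulrDl -scalerAl linearPl.
- rewrite !(mul_linear _ _ f Y Z) IY IZ !scalerDr !scalerA (mulrC e f).
  exact: addrACA.
- by rewrite !mul_tens mulrDl -scalerAl linearPr.
Qed.

Lemma tpmul_tens (a : A) (b : B) (c : A) (d : B) : tpmul (a \ox b) (c \ox d) = (a * c) \ox (b * d).
Proof. by rewrite /tpmul (tens_ext_tens (tpmul_bilinear _)) mul_tens. Qed.

Lemma tpmul_linearl Y : linear (tpmul^~ Y).
Proof. exact/tens_ext_linear/tpmul_bilinear. Qed.

Lemma tpmul_linearr X : linear (tpmul X).
Proof.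
elim/tprod_ind: X => [e X Y IX IY f Z T|a b].
  rewrite !tpmul_linearl IX IY !scalerDr !scalerA (mulrC f e).
  exact: addrACA.
move=> f Z T; rewrite /tpmul !(tens_ext_tens (tpmul_bilinear _)).
exact: mul_linear.
Qed.

Fact tpmulA : associative tpmul.
Proof.
move=> X Y Z; elim/tprod_ind: X => [e X X' IX IX'|a b].
  by rewrite !tpmul_linearl IX IX'.
elim/tprod_ind: Y => [e Y Y' IY IY'|c d].
  by rewrite tpmul_linearr !tpmul_linearl tpmul_linearr IY IY'.
elim/tprod_ind: Z => [e Z Z' IZ IZ'|f g].
  by rewrite !tpmul_linearr IZ IZ'.
by rewrite !tpmul_tens !mulrA.
Qed.

Fact tpmul1X : left_id (1 \ox 1) tpmul.
Proof.
elim/tprod_ind => [e X Y IX IY|a b]; last by rewrite tpmul_tens !mul1r.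
by rewrite tpmul_linearr IX IY.
Qed.

Fact tpmulX1 : right_id (1 \ox 1) tpmul.
Proof.
elim/tprod_ind => [e X Y IX IY|a b]; last by rewrite tpmul_tens !mulr1.
by rewrite tpmul_linearl IX IY.
Qed.

Fact tpmulDl : left_distributive tpmul +%R.
Proof. by move=> X Y Z; have := tpmul_linearl Z 1 X Y; rewrite !scale1r. Qed.

Fact tpmulDr : right_distributive tpmul +%R.
Proof. by move=> X Y Z; have := tpmul_linearr X 1 Y Z; rewrite !scale1r. Qed.

End TensorProductAlgebra.

Section Coshuffle.
Variables (k : fieldType) (V : lmodType k).
Local Notation T := (tensalg V).
Local Notation TT := (T \ox T)%type.

(* The counit witnesses 1 \ox 1 != 0, which the ring structure requires. *)
Fact tone2_neq0 : (1 : T) \ox (1 : T) != 0.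
Proof.
pose f (X Y : T) : k^o := teps X * teps Y.
have fB : bilinear_for *:%R *:%R f.
  split=> [Y a X X'|X a Y Y']; rewrite /f teps_linear.
    by rewrite mulrDl -mulrA.
  by rewrite mulrDr mulrCA.
have f0 : tens_ext f 0 = 0.
  have := tens_ext_linear fB (-1) (1 \ox 1) (1 \ox 1).
  by rewrite !scaleN1r !addNr.
apply/eqP => /(congr1 (tens_ext f)); rewrite f0 (tens_ext_tens fB) /f rmorph1.
by rewrite mul1r; apply/eqP/oner_neq0.
Qed.

HB.instance Definition _ := GRing.Zmodule_isNzRing.Build TT
  (@tpmulA k T T) (@tpmul1X k T T) (@tpmulX1 k T T) (@tpmulDl k T T)
  (@tpmulDr k T T) tone2_neq0.

Lemma tensM (X Y Z W : T) : (X \ox Y) * (Z \ox W) = (X * Z) \ox (Y * W).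
Proof. exact: tpmul_tens. Qed.

Fact tpmulZl (a : k) (X Y : TT) : a *: (X * Y) = (a *: X) * Y.
Proof.
have := tpmul_linearl Y a X 0; rewrite -[tpmul 0 Y]/(0 * Y).
by rewrite mul0r !addr0 => /esym.
Qed.
HB.instance Definition _ := GRing.Lmodule_isLalgebra.Build k TT tpmulZl.

Fact tpmulZr (a : k) (X Y : TT) : a *: (X * Y) = X * (a *: Y).
Proof.
have := tpmul_linearr X a Y 0; rewrite -[tpmul X 0]/(X * 0).
by rewrite mulr0 !addr0 => /esym.
Qed.
HB.instance Definition _ := GRing.Lalgebra_isAlgebra.Build k TT tpmulZr.

Definition primitive (x : V) : TT := letter x \ox 1 + 1 \ox letter x.

Fact primitive_linear : linear primitive.
Proof.
move=> a x y; rewrite /primitive !linearP linearPl linearPr scalerDr.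
exact: addrACA.
Qed.
HB.instance Definition _ :=
  GRing.isLinear.Build k V TT *:%R primitive primitive_linear.

Definition coshuffle : {lrmorphism T -> TT} := alg_ext primitive.

(* [sweedler f X] is the sum of the f X_1 X_2. *)
Definition sweedler (W : lmodType k) (f : T -> T -> W) (X : T) : W :=
  tens_ext f (coshuffle X).

Lemma coshuffle_cons x w :
  coshuffle (word (x :: w)) = primitive x * coshuffle (word w).
Proof. by rewrite /= !alg_ext_word big_cons. Qed.

Lemma coshuffle1 : coshuffle (word [::]) = 1 \ox 1.
Proof. by rewrite word0 rmorph1. Qed.

Lemma sweedler_linear (W : lmodType k) (f : T -> T -> W) :
  bilinear_for *:%R *:%R f -> linear (sweedler f).
Proof.
by move=> fB a X Y; rewrite /sweedler linearP (tens_ext_linear fB).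
Qed.

Fact counit_r_bilinear :
  bilinear_for *:%R *:%R (fun X1 X2 : T => teps X2 *: X1 : T).
Proof.
split=> [Y a Z Z'|Y a Z Z'] /=.
  by rewrite scalerDr !scalerA (mulrC a).
by rewrite teps_linear scalerDl scalerA.
Qed.

Lemma counit_r X : sweedler (fun X1 X2 => teps X2 *: X1 : T) X = X.
Proof.
have fB := counit_r_bilinear; set f := (fun X1 X2 : T => _) in fB *.
apply: (tensalg_eq (sweedler_linear fB) (g := id)) => // w.
elim: w => [|x w IH].
  by rewrite /sweedler coshuffle1 (tens_ext_tens fB) /f rmorph1 scale1r.
rewrite /sweedler coshuffle_cons -cat1s wordM -[in RHS]IH /sweedler.
elim/tprod_ind: (coshuffle (word w)) => [a Y Z IY IZ|Y Z].
  rewrite mulrDr -scalerAr !(tens_ext_linear fB) IY IZ.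
  by rewrite mulrDr -scalerAr.
rewrite mulrDl !tensM.
have := tens_ext_linear fB 1 ((letter x * Y) \ox (1 * Z))
  ((1 * Y) \ox (letter x * Z)).
rewrite !scale1r => ->; rewrite !(tens_ext_tens fB) /f !mul1r rmorphM /=.
by rewrite teps_word /= mul0r scale0r addr0 scalerAr.
Qed.

End Coshuffle.

Section PostHopf.
Variables (k : fieldType) (V : lmodType k) (mag : {bilinear V -> V -> V}).
Local Notation T := (tensalg V).

(* y_1 ... y_(i-1) (x |> y_i) y_(i+1) ... y_n, with i counted from 0. *)
Definition act_at (x : V) (w : seq V) (i : nat) : seq V :=
  take i w ++ mag x w`_i :: drop i.+1 w.

Fixpoint word_act_rec (n : nat) (w : seq V) (a : V) : V :=
  match n, w with
  | n'.+1, x :: w' =>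
      mag x (word_act_rec n' w' a)
      - \sum_(i < size w') word_act_rec n' (act_at x w' i) a
  | _, _ => a
  end.

(* w |> a for a word w and a letter a. *)
Definition word_act (w : seq V) (a : V) : V := word_act_rec (size w) w a.

Lemma size_act_at x w i : (i < size w)%N -> size (act_at x w i) = size w.
Proof.
move=> lt_i; rewrite size_cat /= size_take size_drop lt_i.
by rewrite subnS prednK ?subn_gt0 // subnKC // ltnW.
Qed.

Lemma word_act_nil a : word_act [::] a = a. Proof. by []. Qed.

Lemma word_act_cons x w a : word_act (x :: w) a =
  mag x (word_act w a) - \sum_(i < size w) word_act (act_at x w i) a.
Proof.
by congr (_ - _); apply: eq_bigr => i _; rewrite /word_act size_act_at.
Qed.

Lemma word_act_linear w : linear (word_act w).
Proof.
have [n] := ubnP (size w); elim: n w => // n IH [|x w] //= ltn b a a'.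
rewrite !word_act_cons IH // linearPr scalerBr.
rewrite (eq_bigr (fun i : 'I_(size w) =>
  b *: word_act (act_at x w i) a + word_act (act_at x w i) a')); last first.
  by move=> i _; rewrite IH // size_act_at.
by rewrite big_split -scaler_sumr opprD; apply: addrACA.
Qed.

Lemma sum_act_at_cat (W : zmodType) (F : seq V -> W) x u v :
  \sum_(i < size (u ++ v)) F (act_at x (u ++ v) i) =
  \sum_(i < size u) F (act_at x u i ++ v) +
  \sum_(i < size v) F (u ++ act_at x v i).
Proof.
rewrite size_cat big_split_ord /=; congr (_ + _); apply: eq_bigr => i _.
  rewrite /act_at takel_cat ?(ltnW (ltn_ord i)) // nth_cat ltn_ord.
  rewrite drop_cat -catA /=; case: ltnP => // le_i.
  have Ei : i.+1 = size u by apply/eqP; rewrite eqn_leq le_i ltn_ord.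
  by rewrite Ei subnn drop0 drop_size.
rewrite /act_at take_cat ltnNge leq_addr /= addKn nth_cat ltnNge leq_addr /=.
by rewrite addKn drop_cat ltnNge leqW ?leq_addr //= -addnS addKn catA.
Qed.

Lemma word_act_multilinear a : multilinear (word_act^~ a).
Proof.
have sumE x u v : \sum_(i < size (u ++ v)) word_act (act_at x (u ++ v) i) a =
    \sum_(i < size u) word_act (act_at x u i ++ v) a +
    \sum_(i < size v) word_act (u ++ act_at x v i) a.
  exact: (sum_act_at_cat (word_act^~ a)).
move=> b p y z q /=; have [n] := ubnP (size p + size q).
elim: n p y z q => // n IH [|x p] y z q ltn; rewrite /= !word_act_cons.
  rewrite linearPl scalerBr scaler_sumr addrACA -opprD -big_split /=.
  congr (_ - _); apply: eq_bigr => i _; rewrite /act_at linearPl /=.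
  rewrite IH // size_take size_drop ltn_ord.
  by rewrite -[(_ < n)%N]ltnS -addnS -subSn // subSS subnKC // ltnW.
rewrite IH // linearPr /= scalerBr addrACA -opprD; congr (_ - _).
rewrite !sumE scalerDr addrACA; congr (_ + _).
  rewrite scaler_sumr -big_split; apply: eq_bigr => i _.
  by rewrite IH // size_act_at.
rewrite !big_ord_recl /act_at /= ?take0 ?drop0 /= scalerDr addrACA.
congr (_ + _); first by rewrite linearPr /= IH.
rewrite scaler_sumr -big_split; apply: eq_bigr => i _ /=.
by have /= -> := IH p y z (act_at x q i); rewrite ?size_act_at.
Qed.

(* X |> a for a letter a. *)
Definition act (X : T) (a : V) : V := word_ext (word_act^~ a) X.

Lemma act_word w a : act (word w) a = word_act w a.
Proof. exact: (word_ext_word (word_act_multilinear a)). Qed.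

Lemma act_bilinear : bilinear_for *:%R *:%R act.
Proof.
split=> [a|X]; first exact: (word_ext_linear (word_act_multilinear a)).
move=> b a a'; elim/tensalg_ind: X => [c X Y IX IY|w] /=.
  have actD d : act (c *: X + Y) d = c *: act X d + act Y d.
    exact: (word_ext_linear (word_act_multilinear d)).
  rewrite !actD IX IY !scalerDr !scalerA (mulrC c b).
  exact: addrACA.
by rewrite !act_word word_act_linear.
Qed.
HB.instance Definition _ := bilinear_isBilinear.Build k T V V
  *:%R *:%R act act_bilinear.

(* X |> a_1...a_n = (X_1 |> a_1) ... (X_n |> a_n), the iterated coproduct being
   unfolded from the left; the final X |> 1 = teps X *: 1 is absorbed by the
   counit law, see [rhd_letter]. *)
Fixpoint rhd_word (w : seq V) (X : T) : T :=
  match w with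
  | [::] => teps X *: 1
  | a :: w' => sweedler (fun X1 X2 => letter (act X1 a) * rhd_word w' X2 : T) X
  end.

Fact rhd_word_bilinear a w : linear (rhd_word w) ->
  bilinear_for *:%R *:%R (fun X1 X2 => letter (act X1 a) * rhd_word w X2 : T).
Proof.
move=> wL; split=> [Y b X X'|X b Y Y'] /=.
  by rewrite linearPl linearP mulrDl -scalerAl.
by rewrite wL mulrDr -scalerAr.
Qed.

Lemma rhd_word_linear w : linear (rhd_word w).
Proof.
elim: w => [|a w IH] b X Y /=; first by rewrite linearP scalerDl scalerA.
by rewrite (sweedler_linear (rhd_word_bilinear a IH)).
Qed.

Lemma sweedler_comb (W : lmodType k) (f g h : T -> T -> W) b X :
  bilinear_for *:%R *:%R f -> bilinear_for *:%R *:%R g ->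
  bilinear_for *:%R *:%R h ->
  (forall Y Z, f Y Z = b *: g Y Z + h Y Z) ->
  sweedler f X = b *: sweedler g X + sweedler h X.
Proof.
move=> fB gB hB E; rewrite /sweedler.
elim/tprod_ind: (coshuffle V X) => [c Y Z IY IZ|Y Z].
  rewrite !(tens_ext_linear fB, tens_ext_linear gB, tens_ext_linear hB).
  rewrite IY IZ !scalerDr !scalerA (mulrC c b); exact: addrACA.
by rewrite !tens_ext_tens.
Qed.

Lemma rhd_word_multilinear X : multilinear (rhd_word^~ X).
Proof.
move=> b p x y q; elim: p X => [|a p IH] X /=; apply: sweedler_comb;
  try by apply: rhd_word_bilinear; apply: rhd_word_linear.
- by move=> Y Z; rewrite linearPr linearP mulrDl -scalerAl.
- by move=> Y Z; rewrite IH mulrDr -scalerAr.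
Qed.

Definition rhd (X Y : T) : T := word_ext (rhd_word^~ X) Y.

Lemma rhd_wordE X w : rhd X (word w) = rhd_word w X.
Proof. exact: (word_ext_word (rhd_word_multilinear X)). Qed.

Lemma rhd_bilinear : bilinear_for *:%R *:%R rhd.
Proof.
split=> [Y|X]; last exact: (word_ext_linear (rhd_word_multilinear X)).
move=> b X X'; elim/tensalg_ind: Y => [c Y Z IY IZ|w] /=.
  have rhdD U : rhd U (c *: Y + Z) = c *: rhd U Y + rhd U Z.
    exact: (word_ext_linear (rhd_word_multilinear U)).
  rewrite !rhdD IY IZ !scalerDr !scalerA (mulrC c b); exact: addrACA.
by rewrite !rhd_wordE rhd_word_linear.
Qed.
HB.instance Definition _ := bilinear_isBilinear.Build k T T T
  *:%R *:%R rhd rhd_bilinear.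

Lemma rhd1 X : rhd X 1 = teps X *: 1.
Proof. by rewrite -word0 rhd_wordE. Qed.

Lemma rhd_letter X a : rhd X (letter a) = letter (act X a).
Proof.
rewrite rhd_wordE -[in RHS](counit_r X) /= /sweedler.
have fB := rhd_word_bilinear a (rhd_word_linear [::]).
have gB := @counit_r_bilinear k V.
elim/tprod_ind: (coshuffle V X) => [c Y Z IY IZ|Y Z].
  rewrite (tens_ext_linear fB) (tens_ext_linear gB) IY IZ.
  by rewrite linearPl linearP.
rewrite (tens_ext_tens fB) (tens_ext_tens gB) /=.
by rewrite linearZl linearZ -scalerAr mulr1.
Qed.

(* The product of the sub-adjacent Hopf algebra: X o Y = X_1 (X_2 |> Y). *)
Definition circ (X Y : T) : T := sweedler (fun X1 X2 => X1 * rhd X2 Y : T) X.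

Lemma circ_bilinear : bilinear_for *:%R *:%R circ.
Proof.
have B Y : bilinear_for *:%R *:%R (fun X1 X2 => X1 * rhd X2 Y : T).
  split=> [Z b X X'|Z b X X'] /=; first by rewrite mulrDl -scalerAl.
  by rewrite linearPl mulrDr -scalerAr.
split=> [Y|X b Y Y'] /=; first exact: sweedler_linear.
apply: sweedler_comb => // Z W; by rewrite linearPr mulrDr -scalerAr.
Qed.
HB.instance Definition _ := bilinear_isBilinear.Build k T T T
  *:%R *:%R circ circ_bilinear.

(* S is the antipode of (tensalg V, circ, 1, coshuffle, teps), i.e. the
   convolution inverse of the identity. *)
Definition is_antipode (S : T -> T) : Prop :=
  (forall X, sweedler (fun X1 X2 => circ (S X1) X2) X = teps X *: 1) /\
  (forall X, sweedler (fun X1 X2 => circ X1 (S X2)) X = teps X *: 1).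

(* The bilinear product with value (-1)^|w| S(w) |> Y on a word w and Y. *)
Definition brhd (S : T -> T) (X Y : T) : T :=
  word_ext (fun w => (-1) ^+ size w *: rhd (S (word w)) Y) X.

Lemma brhd_word (S : {linear T -> T}) w Y :
  brhd S (word w) Y = (-1) ^+ size w *: rhd (S (word w)) Y.
Proof.
apply: (word_ext_word (f := fun w => (-1) ^+ size w *: rhd (S (word w)) Y)).
move=> b p x y q; rewrite word_multilinear linearP linearPl scalerDr !scalerA.
by rewrite !size_cat /= mulrC.
Qed.

End PostHopf.

Section PartitionFormula.
Variables (k : fieldType) (V : lmodType k) (m : nat) (x : m.-tuple V).

(* The word x_I; enum lists I in increasing order. *)
Definition subword (I : {set 'I_m}) : seq V := [seq tnth x i | i <- enum I].

(* The letters x_(b_1), x_(b_2), ... for I = {b_1 > b_2 > ...}. *)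
Definition desc_letters (I : {set 'I_m}) : seq V := rev (subword I).

(* (B_1, ..., B_(p+1)) is a partition of [m] into possibly empty blocks, the
   last of which has exactly p elements. Indices are counted from 0. *)
Definition admissible (p : nat) (B : {ffun 'I_p.+1 -> {set 'I_m}}) : bool :=
  [&& [forall i, forall j, (i != j) ==> [disjoint B i & B j]],
      \bigcup_i B i == [set: 'I_m]
    & #|B ord_max| == p].

Definition partition_term (mag : {bilinear V -> V -> V})
    (S : tensalg V -> tensalg V) (p : nat)
    (B : {ffun 'I_p.+1 -> {set 'I_m}}) : tensalg V :=
  \prod_(j < p)
    brhd mag S (word (subword (B (widen_ord (leqnSn p) j))))
               (letter (desc_letters (B ord_max))`_j).

End PartitionFormula.

(* Main.v *)
(* Write L(X) = X |> _ and L'(X) = S(X) |> _. The identity (X o Y) |> Z =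
   X |> (Y |> Z) makes L' the convolution inverse of L, and since L(X) acts on
   products through the coproduct, cocommutativity gives the same for L'. The
   antipode equation reads X_1 (X_2 |> S(X_3)) = eps(X), so X_1 |> S(X_2) is the
   concatenation antipode S_0(X), and inverting L gives S(X) = L'(X_1) S_0(X_2).
   On a word, S_0(X_2) is the reversed subword of the last block B_(p+1), up to
   sign, and distributing L'(X_1) over its letters produces the other blocks. *)

Require Import Defs.
From mathcomp Require Import all_boot all_order all_algebra sesquilinear.

Import GRing.Theory.
Local Open Scope ring_scope.

Set Implicit Arguments.
Unset Strict Implicit.
Unset Printing Implicit Defensive.

(** * Sums over the splittings of a word into two complementary subwords *)

Section Splits.
Variable A : Type.

(* The pairs (w_I, w_J) for I, J complementary sets of positions of w: the
   terms of the coshuffle coproduct of w. *)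
Fixpoint splits (w : seq A) : seq (seq A * seq A) :=
  if w is x :: w' then
    [seq (x :: p.1, p.2) | p <- splits w'] ++
    [seq (p.1, x :: p.2) | p <- splits w']
  else [:: ([::], [::])].

Lemma big_splits_nil (M : nmodType) (F : seq A -> seq A -> M) :
  \sum_(p <- splits [::]) F p.1 p.2 = F [::] [::].
Proof. by rewrite /= big_seq1. Qed.

Lemma big_splits_cons (M : nmodType) (F : seq A -> seq A -> M) x w :
  \sum_(p <- splits (x :: w)) F p.1 p.2 =
  \sum_(p <- splits w) F (x :: p.1) p.2 + \sum_(p <- splits w) F p.1 (x :: p.2).
Proof. by rewrite /= big_cat !big_map. Qed.

Lemma splits_coassoc (M : nmodType) (F : seq A -> seq A -> seq A -> M) w :
  \sum_(p <- splits w) \sum_(q <- splits p.1) F q.1 q.2 p.2 =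
  \sum_(p <- splits w) \sum_(q <- splits p.2) F p.1 q.1 q.2.
Proof.
elim: w F => [|x w IH] F; first by do !rewrite /= big_seq1.
rewrite (big_splits_cons (fun u v => \sum_(q <- splits u) F q.1 q.2 v)).
rewrite (big_splits_cons (fun u v => \sum_(q <- splits v) F u q.1 q.2)).
under eq_bigr do rewrite (big_splits_cons (fun a b => F a b _)).
under [X in _ = _ + X]eq_bigr do rewrite (big_splits_cons (F _)).
rewrite !big_split /= (IH (fun a b c => F (x :: a) b c)).
by rewrite (IH (fun a b c => F a (x :: b) c)) (IH (fun a b c => F a b (x :: c))) addrA.
Qed.

(** Cocommutativity, as a swap of the two middle factors of the fourfold coproduct. Each letter goes
    to one of four subwords, and the swap only permutes these choices, whence the final
    [addrACA]. *)
Lemma splits_medial (M : nmodType)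
    (F : seq A -> seq A -> seq A -> seq A -> M) w :
  \sum_(p <- splits w) \sum_(q <- splits p.1) \sum_(r <- splits p.2)
     F q.1 q.2 r.1 r.2 =
  \sum_(p <- splits w) \sum_(q <- splits p.1) \sum_(r <- splits p.2)
     F q.1 r.1 q.2 r.2.
Proof.
elim: w F => [|x w IH] F; first by do !rewrite /= big_seq1.
have E G : \sum_(p <- splits (x :: w)) \sum_(q <- splits p.1)
      \sum_(r <- splits p.2) G q.1 q.2 r.1 r.2 =
    \sum_(p <- splits w) \sum_(q <- splits p.1) \sum_(r <- splits p.2)
      (G (x :: q.1) q.2 r.1 r.2 + G q.1 (x :: q.2) r.1 r.2 +
       (G q.1 q.2 (x :: r.1) r.2 + G q.1 q.2 r.1 (x :: r.2))) :> M.
  rewrite (big_splits_cons (fun u v => \sum_(q <- splits u)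
    \sum_(r <- splits v) G q.1 q.2 r.1 r.2)) -big_split.
  apply: eq_bigr => p _; rewrite (big_splits_cons (fun a b =>
    \sum_(r <- splits p.2) G a b r.1 r.2)) -!big_split.
  apply: eq_bigr => q _; rewrite (big_splits_cons (fun a b =>
    G q.1 q.2 a b)) -!big_split.
  by [].
rewrite E (E (fun a b c d => F a c b d)).
rewrite (IH (fun a b c d => F (x :: a) b c d + F a (x :: b) c d +
  (F a b (x :: c) d + F a b c (x :: d)))).
do 3![apply: eq_bigr => ? _]; exact: addrACA.
Qed.

(** Length bookkeeping for signs: under the sum, $(-1)^{|w|}$ may be factored as
    $(-1)^{|u|}(-1)^{|v|}$. *)
Lemma eq_big_splits (M : nmodType) (F G : seq A -> seq A -> M) w :
  (forall u v, (size u + size v)%N = size w -> F u v = G u v) ->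
  \sum_(p <- splits w) F p.1 p.2 = \sum_(p <- splits w) G p.1 p.2.
Proof.
elim: w F G => [|x w IH] F G FG; first by rewrite /= !big_seq1 FG.
rewrite !big_splits_cons; congr (_ + _);
  [apply: (IH (fun u v => F (x :: u) v) (fun u v => G (x :: u) v)) |
   apply: (IH (fun u v => F u (x :: v)) (fun u v => G u (x :: v)))];
  by move=> u v /= Ew; apply: FG => /=; rewrite ?addSn ?addnS Ew.
Qed.

Lemma splits_counitl (R : pzRingType) (M : lmodType R) (F : seq A -> M) w :
  \sum_(p <- splits w) (nilp p.1)%:R *: F p.2 = F w.
Proof.
elim: w F => [|x w IH] F; first by rewrite /= big_seq1 scale1r.
rewrite (big_splits_cons (fun u v => (nilp u)%:R *: F v)) big1 ?add0r.
  exact: (IH (fun v => F (x :: v))).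
by move=> p _; rewrite scale0r.
Qed.

Lemma splits_counitr (R : pzRingType) (M : lmodType R) (F : seq A -> M) w :
  \sum_(p <- splits w) (nilp p.2)%:R *: F p.1 = F w.
Proof.
elim: w F => [|x w IH] F; first by rewrite /= big_seq1 scale1r.
rewrite (big_splits_cons (fun u v => (nilp v)%:R *: F u)).
rewrite [X in _ + X]big1 ?addr0; first exact: (IH (fun v => F (x :: v))).
by move=> p _; rewrite scale0r.
Qed.

End Splits.

Lemma splits_map (A B : Type) (f : A -> B) w :
  splits (map f w) = [seq (map f p.1, map f p.2) | p <- splits w].
Proof. by elim: w => //= x w ->; rewrite map_cat -!map_comp. Qed.

(** Serves maps such as [tens_ext f], whose linearity is a proved predicate and not a bundled
    structure. *)
Lemma linear_predicate_sum (R : pzRingType) (U W : lmodType R) (f : U -> W) :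
  linear f -> forall I (r : seq I) (F : I -> U),
  f (\sum_(i <- r) F i) = \sum_(i <- r) f (F i).
Proof.
move=> fL I r F; have f0 : f 0 = 0.
  by have := fL (-1) 0 0; rewrite !scaleN1r !addNr.
elim: r => [|i r IH]; first by rewrite !big_nil.
by rewrite !big_cons -IH -[F i in LHS]scale1r fL scale1r.
Qed.

(** * The coshuffle coproduct on words *)

Section Coproduct.
Variables (k : fieldType) (V : lmodType k).
Local Notation T := (tensalg V).

Lemma coshuffle_word (w : seq V) :
  coshuffle V (word w) = \sum_(p <- splits w) word p.1 \ox word p.2.
Proof.
elim: w => [|x w IH].
  by rewrite coshuffle1 (big_splits_nil (fun u v => word u \ox word v)).
rewrite (big_splits_cons (fun u v => word u \ox word v)).
rewrite coshuffle_cons IH mulrDl !mulr_sumr.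
by congr (_ + _); apply: eq_bigr => p _; rewrite tensM mul1r -wordM.
Qed.

Lemma sweedler_word (W : lmodType k) (f : T -> T -> W) w :
  bilinear_for *:%R *:%R f ->
  sweedler f (word w) = \sum_(p <- splits w) f (word p.1) (word p.2).
Proof.
move=> fB; rewrite /sweedler coshuffle_word.
rewrite (linear_predicate_sum (tens_ext_linear fB)).
by apply: eq_bigr => p _; rewrite tens_ext_tens.
Qed.

End Coproduct.

(** * The action [rhd] of words and its compatibility with [circ] *)

Section PostHopfTheory.
Variables (k : fieldType) (V : lmodType k) (mag : {bilinear V -> V -> V}).
Local Notation T := (tensalg V).
Local Notation act_at := (act_at mag).
Local Notation rhd := (rhd mag).
Local Notation circ := (circ mag).

Lemma word_cons (x : V) w : word (x :: w) = letter x * word w.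
Proof. exact: (wordM [:: x] w). Qed.

(** The action of a letter is a coderivation: the replaced letter lies in exactly one of the two
    subwords. *)
Lemma splits_act_at (M : nmodType) (F : seq V -> seq V -> M) x w :
  \sum_(i < size w) \sum_(p <- splits (act_at x w i)) F p.1 p.2 =
  \sum_(p <- splits w) (\sum_(i < size p.1) F (act_at x p.1 i) p.2 +
                        \sum_(i < size p.2) F p.1 (act_at x p.2 i)).
Proof.
have act0 y v : act_at x (y :: v) 0 = mag x y :: v.
  by rewrite /Defs.act_at /= drop0.
have actS y v i : act_at x (y :: v) i.+1 = y :: act_at x v i by [].
elim: w F => [|y w IH] F; first by rewrite /= big_seq1 !big_ord0 addr0.
rewrite (big_splits_cons (fun u v => \sum_(i < size u) F (act_at x u i) v +
  \sum_(i < size v) F u (act_at x v i))) /=.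
rewrite big_ord_recl act0 (big_splits_cons F).
under [X in _ + X = _]eq_bigr => i _ do rewrite actS (big_splits_cons F).
rewrite big_split /= (IH (fun u v => F (y :: u) v)) (IH (fun u v => F u (y :: v))).
rewrite -!big_split; apply: eq_bigr => p _ /=.
by rewrite !big_ord_recl !act0 [X in _ = _ + X]addrCA -[X in _ = X + _]addrA addrACA.
Qed.

Lemma rhd_word_letterM w a Z : rhd (word w) (letter a * Z) =
  \sum_(p <- splits w) letter (word_act mag p.1 a) * rhd (word p.2) Z.
Proof.
elim/tensalg_ind: Z => [b Y Z IY IZ|z].
  rewrite mulrDr -scalerAr linearPr /= IY IZ scaler_sumr -big_split.
  by apply: eq_bigr => p _; rewrite linearPr mulrDr -scalerAr.
rewrite -word_cons rhd_wordE /= sweedler_word; last first.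
  exact/rhd_word_bilinear/rhd_word_linear.
by apply: eq_bigr => p _; rewrite act_word rhd_wordE.
Qed.

Lemma rhd1l Z : rhd 1 Z = Z.
Proof.
elim/tensalg_ind: Z => [b Y Z IY IZ|z]; first by rewrite linearPr /= IY IZ.
elim: z => [|a z IH]; first by rewrite word0 rhd1 rmorph1 scale1r.
by rewrite word_cons -word0 rhd_word_letterM /= big_seq1 word_act_nil IH.
Qed.

(** A letter is primitive, so it acts as a derivation of concatenation. *)
Lemma rhd_letter_word x u Z : rhd (letter x) (word u * Z) =
  \sum_(i < size u) word (act_at x u i) * Z + word u * rhd (letter x) Z.
Proof.
elim: u => [|a u IH]; first by rewrite big_ord0 add0r word0 !mul1r.
rewrite word_cons -mulrA rhd_word_letterM /= !(big_cons, big_nil) /= addr0.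
rewrite -/(letter x) rhd1l IH word_act_nil word_act_cons word_act_nil.
rewrite /= big_ord0 subr0 big_ord_recl.
rewrite /Defs.act_at /= drop0 word_cons -!mulrA -addrA; congr (_ + _).
rewrite mulrDr mulr_sumr; congr (_ + _).
by apply: eq_bigr => i _; rewrite word_cons mulrA.
Qed.

Lemma rhd_letterE x u :
  rhd (letter x) (word u) = \sum_(i < size u) word (act_at x u i).
Proof.
have := rhd_letter_word x u 1; rewrite mulr1 rhd1 teps_word scale0r mulr0 addr0.
by move=> ->; apply: eq_bigr => i _; rewrite mulr1.
Qed.

(** The recursion defining the action on single letters persists on all of [T]. By induction on the
    word [z]: in the coproduct, [x] acts on the first letter or on the rest, and [splits_act_at]
    distributes the corrections likewise. *)
Lemma rhd_word_cons x w Z : rhd (word (x :: w)) Z =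
  rhd (letter x) (rhd (word w) Z) - \sum_(i < size w) rhd (word (act_at x w i)) Z.
Proof.
elim/tensalg_ind: Z => [b Y Z IY IZ|z].
  rewrite !linearPr /= IY IZ scalerBr addrACA -opprD; congr (_ - _).
  by rewrite scaler_sumr -big_split; apply: eq_bigr => i _; rewrite linearPr.
elim: z w => [|a z IH] w.
  (* All terms vanish: the counit kills nonempty words, and [act_at] always contains the replaced
     letter. *)
  rewrite word0 !rhd1 linearZr_LR /= rhd1 !teps_word /= !scale0r scaler0 big1 ?subr0 //.
  move=> i _; rewrite rhd1 teps_word /Defs.act_at /nilp size_cat addnS.
  by rewrite scale0r.
rewrite (word_cons a) rhd_word_letterM.
rewrite (big_splits_cons
  (fun u v => letter (word_act mag u a) * rhd (word v) (word z))).
rewrite rhd_word_letterM linear_sumr.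
under [X in _ = _ - X]eq_bigr do rewrite rhd_word_letterM.
rewrite (splits_act_at
  (fun u v => letter (word_act mag u a) * rhd (word v) (word z))).
rewrite -big_split -sumrB; apply: eq_bigr => p _ /=.
rewrite word_act_cons IH (rhd_letter_word x [:: _]) big_ord1 /=.
rewrite linearB mulrBl mulrBr opprD [RHS]addrACA; congr (_ - _ + (_ - _)).
  by rewrite linear_sum mulr_suml.
by rewrite mulr_sumr.
Qed.

(** Bilinear form of [rhd_word_cons], for use with [circ (word w) Y] as the left factor, which is
    not a word. *)
Lemma rhd_letterMl x Y Z :
  rhd (letter x * Y) Z = rhd (letter x) (rhd Y Z) - rhd (rhd (letter x) Y) Z.
Proof.
elim/tensalg_ind: Y => [b Y Y' IY IY'|w].
  rewrite mulrDr -scalerAr !(linearPl, linearPr) /= IY IY' scalerBr.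
  by rewrite addrACA opprD.
by rewrite -word_cons rhd_word_cons rhd_letterE linear_sumlz.
Qed.

Lemma circ_word w Y :
  circ (word w) Y = \sum_(p <- splits w) word p.1 * rhd (word p.2) Y.
Proof.
rewrite /circ sweedler_word //; split=> [Z b X X'|Z b X X'] /=.
  by rewrite mulrDl -scalerAl.
by rewrite linearPl mulrDr -scalerAr.
Qed.

(** This is $(x\circ w)\circ Y=x\circ(w\circ Y)$, written out with $x\circ Z=xZ+x\rhd Z$ for a
    letter $x$. *)
Lemma circ_word_cons x w Y : circ (word (x :: w)) Y =
  letter x * circ (word w) Y + rhd (letter x) (circ (word w) Y)
  - \sum_(i < size w) circ (word (act_at x w i)) Y.
Proof.
rewrite !circ_word (big_splits_cons (fun u v => word u * rhd (word v) Y)).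
under [X in _ = _ - X]eq_bigr do rewrite circ_word.
rewrite (splits_act_at (fun u v => word u * rhd (word v) Y)).
rewrite mulr_sumr linear_sumr -addrA -sumrB.
congr (_ + _); apply: eq_bigr => p _; first by rewrite word_cons mulrA.
(* The derivation terms falling on [p.1] cancel the corrections there; those on [p.2] give
   [rhd_word_cons]. *)
rewrite /= rhd_letter_word opprD addrACA subrr add0r.
by rewrite rhd_word_cons mulrBr mulr_sumr.
Qed.

Lemma rhd_circ X Y Z : rhd (circ X Y) Z = rhd X (rhd Y Z).
Proof.
elim/tensalg_ind: X => [b X X' IX IX'|w]; first by rewrite !linearPl /= IX IX'.
(* Induction on length, because the words [act_at x w i] have the length of [w] but are not its
   tails. *)
have [n] := ubnP (size w); elim: n w => // n IH [|x w] /= lt_n.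
  by rewrite circ_word /= big_seq1 /= word0 mul1r !rhd1l.
(* The correction in [rhd_letterMl] cancels the summand $x\rhd(w\circ Y)$. *)
rewrite circ_word_cons linearBl linearDl /= rhd_letterMl subrK rhd_word_cons.
rewrite IH // linear_sumlz /=; congr (_ - _); apply: eq_bigr => i _.
by rewrite IH // size_act_at.
Qed.

(** * Convolution identities for the antipode *)

Section Antipode.
Variables (S : {linear T -> T}) (S_antipode : is_antipode mag S).

Lemma antipode_circ w :
  \sum_(p <- splits w) circ (S (word p.1)) (word p.2) = teps (word w) *: 1.
Proof.
case: S_antipode => <- _; rewrite sweedler_word //.
split=> [Z b X X'|Z b X X'] /=; first by rewrite linearP linearPl.
by rewrite linearPr.
Qed.

Lemma circ_antipode w :
  \sum_(p <- splits w) circ (word p.1) (S (word p.2)) = teps (word w) *: 1.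
Proof.
case: S_antipode => _ <-; rewrite sweedler_word //.
split=> [Z b X X'|Z b X X'] /=; first by rewrite linearPl.
by rewrite linearP linearPr.
Qed.

Lemma rhd_antipodeK w Y :
  \sum_(p <- splits w) rhd (S (word p.1)) (rhd (word p.2) Y) =
  (nilp w)%:R *: Y.
Proof.
under eq_bigr do rewrite -rhd_circ.
by rewrite -linear_sumlz antipode_circ linearZl /= rhd1l teps_word.
Qed.

Lemma antipode_rhdK w Y :
  \sum_(p <- splits w) rhd (word p.1) (rhd (S (word p.2)) Y) =
  (nilp w)%:R *: Y.
Proof.
under eq_bigr do rewrite -rhd_circ.
by rewrite -linear_sumlz circ_antipode linearZl /= rhd1l teps_word.
Qed.

(** $L'*(L*f)=f$ for convolution, by coassociativity and $L'*L=\varepsilon$. *)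
Lemma rhd_antipode_inverse (f : seq V -> T) w :
  \sum_(p <- splits w)
     rhd (S (word p.1)) (\sum_(q <- splits p.2) rhd (word q.1) (f q.2)) = f w.
Proof.
under eq_bigr do rewrite linear_sumr.
rewrite -(splits_coassoc (fun a b c => rhd (S (word a)) (rhd (word b) (f c)))).
under eq_bigr do rewrite rhd_antipodeK.
exact: splits_counitl.
Qed.

(** As $L(u)$ sends $1$ to $\varepsilon(u)1$, evaluating $L'*L=\varepsilon$ at $1$ leaves
    $L'(w)(1)$. *)
Lemma antipode_rhd1 w : rhd (S (word w)) 1 = (nilp w)%:R *: 1.
Proof.
rewrite -[RHS](rhd_antipodeK w 1).
rewrite -[LHS](splits_counitr (fun u => rhd (S (word u)) 1)).
by apply: eq_bigr => p _; rewrite [in RHS](rhd1 _ (word _)) teps_word linearZr.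
Qed.

(** With [G] the right-hand side, it suffices that $L*G=\varepsilon\cdot aZ$: convolving with $L'$
    on the left then gives $G=L'(\cdot)(aZ)$. *)
Lemma antipode_rhd_letterM w a Z : rhd (S (word w)) (letter a * Z) =
  \sum_(p <- splits w) rhd (S (word p.1)) (letter a) * rhd (S (word p.2)) Z.
Proof.
pose G u := \sum_(p <- splits u)
  rhd (S (word p.1)) (letter a) * rhd (S (word p.2)) Z.
suff LG u : \sum_(q <- splits u) rhd (word q.1) (G q.2) =
    (nilp u)%:R *: (letter a * Z).
  rewrite -/(G w) -(rhd_antipode_inverse G).
  rewrite -[LHS](splits_counitr (fun u => rhd (S (word u)) (letter a * Z))).
  by apply: eq_bigr => p _; rewrite LG linearZr.
pose F b c d e := rhd (word b) (rhd (S (word d)) (letter a)) *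
                  rhd (word c) (rhd (S (word e)) Z).
transitivity (\sum_(p <- splits u) \sum_(q <- splits p.1)
                \sum_(r <- splits p.2) F q.1 q.2 r.1 r.2).
  apply: eq_bigr => p _; rewrite linear_sumr exchange_big /=.
  apply: eq_bigr => r _; rewrite rhd_letter rhd_word_letterM.
  by apply: eq_bigr => q _; rewrite /F !rhd_letter act_word.
(* The swap puts each $L$ next to the $L'$ it is applied to, so $L*L'=\varepsilon$ applies to both
   factors. *)
rewrite splits_medial -(splits_counitl (fun v => (nilp v)%:R *: (letter a * Z))).
apply: eq_bigr => p _; rewrite scalerAr scalerAl.
rewrite -!antipode_rhdK mulr_suml; apply: eq_bigr => q _.
by rewrite mulr_sumr.
Qed.

(** The first letter of [w] ends the reversed left subword or begins the right one; both choices
    give the same word, with opposite signs. *)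
Lemma concat_antipode_mul (w : seq V) :
  \sum_(p <- splits w) (-1) ^+ size p.1 *: (word (rev p.1) * word p.2) =
  (nilp w)%:R :> T.
Proof.
case: w => [|x w]; first by rewrite big_seq1 scale1r mul1r.
rewrite (big_splits_cons
  (fun u v => (-1) ^+ size u *: (word (rev u) * word v))).
rewrite -big_split big1 //= => p _; rewrite -!wordM rev_cons cat_rcons.
by rewrite exprS mulN1r scaleNr addNr.
Qed.

(** In the concatenation convolution algebra $S_0$ is a left inverse of the identity and [f] a right
    inverse, so they coincide. *)
Lemma word_rhd_antipode w :
  \sum_(p <- splits w) rhd (word p.1) (S (word p.2)) =
  (-1) ^+ size w *: word (rev w).
Proof.
pose f u := \sum_(p <- splits u) rhd (word p.1) (S (word p.2)).
(* The antipode equation for [circ], expanded to $X_1(X_2\rhd S(X_3))=\varepsilon(X)1$ and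
   regrouped. *)
have wf u : \sum_(p <- splits u) word p.1 * f p.2 = (nilp u)%:R.
  transitivity (teps (word u) *: 1 : T); last by rewrite teps_word scaler_nat.
  rewrite -circ_antipode.
  under [RHS]eq_bigr do rewrite circ_word.
  rewrite (splits_coassoc
    (fun a b c => word a * rhd (word b) (S (word c)))).
  by apply: eq_bigr => p _; rewrite mulr_sumr.
rewrite -/(f w) -[LHS](splits_counitl f).
rewrite -[RHS](splits_counitr (fun u => (-1) ^+ size u *: word (rev u))).
under eq_bigr do rewrite scaler_nat -mulr_natl -concat_antipode_mul mulr_suml.
rewrite (splits_coassoc
  (fun a b c => (-1) ^+ size a *: (word (rev a) * word b) * f c)).
apply: eq_bigr => p _; rewrite scaler_nat -[RHS]mulr_natr -wf mulr_sumr.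
by apply: eq_bigr => q _; rewrite -!scalerAl mulrA.
Qed.

Lemma antipode_word w : S (word w) =
  \sum_(p <- splits w)
     rhd (S (word p.1)) ((-1) ^+ size p.2 *: word (rev p.2)).
Proof.
rewrite -[LHS](rhd_antipode_inverse (fun u => S (word u))).
by apply: eq_bigr => p _; rewrite word_rhd_antipode.
Qed.

Local Notation brhd := (brhd mag S).

(** The sign $(-1)^{|u|}$ built into [brhd] turns $(-1)^{|w|}$ into the $(-1)^{|v|}$ of $S_0(v)$. *)
Lemma antipode_word_brhd w : S (word w) =
  (-1) ^+ size w *: \sum_(p <- splits w) brhd (word p.1) (word (rev p.2)).
Proof.
rewrite antipode_word scaler_sumr.
apply: (eq_big_splits
  (F := fun u v => rhd (S (word u)) ((-1) ^+ size v *: word (rev v)))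
  (G := fun u v => (-1) ^+ size w *: brhd (word u) (word (rev v)))).
move=> u v <-; rewrite brhd_word linearZr /= scalerA addnC exprD -mulrA.
by rewrite -expr2 sqrr_sign mulr1.
Qed.

Lemma brhd1 w : brhd (word w) 1 = (nilp w)%:R.
Proof.
rewrite brhd_word antipode_rhd1 scalerA; case: w => [|x w] /=.
  by rewrite mul1r scale1r.
by rewrite mulr0 scale0r.
Qed.

Lemma brhd_letterM w a Z : brhd (word w) (letter a * Z) =
  \sum_(p <- splits w) brhd (word p.1) (letter a) * brhd (word p.2) Z.
Proof.
rewrite brhd_word antipode_rhd_letterM scaler_sumr.
apply: (eq_big_splits
  (F := fun u v => (-1) ^+ size w *:
          (rhd (S (word u)) (letter a) * rhd (S (word v)) Z))
  (G := fun u v => brhd (word u) (letter a) * brhd (word v) Z)).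
by move=> u v <-; rewrite !brhd_word -scalerAl -scalerAr scalerA exprD.
Qed.

End Antipode.
End PostHopfTheory.

(** * Ordered partitions of a finite set into possibly empty blocks *)

Section Blocks.
Variable I : finType.
Implicit Types (A C : {set I}) (p : nat).

(** Distinct entries let a set [C] record the left half; in the inductive step [C] is sorted by
    whether it contains the head [x]. *)
Lemma big_splits_filter (M : nmodType) (F : seq I -> seq I -> M) s : uniq s ->
  \sum_(q <- splits s) F q.1 q.2 =
  \sum_(C : {set I} | C \subset [set y in s])
     F [seq y <- s | y \in C] [seq y <- s | y \notin C].
Proof.
elim: s F => [|x s IH] F.
  move=> _; rewrite /= big_seq1 (big_pred1 set0) // => C /=.
  by rewrite set_nil subset0.
rewrite cons_uniq big_splits_cons => /andP[xs us].
rewrite (IH (fun u v => F (x :: u) v)) // (IH (fun u v => F u (x :: v))) //.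
rewrite [RHS](bigID (fun C : {set I} => x \in C)) /=; congr (_ + _).
  rewrite [RHS](reindex_onto (fun C => x |: C) (fun C => C :\ x)) /=; last first.
    by move=> C /andP[_ xC]; rewrite setD1K.
  apply: eq_big => C.
    rewrite set_cons setU11 andbT; apply/idP/andP => [sC|[sC /eqP <-]].
      have xC : x \notin C by apply/negP => /(subsetP sC); rewrite inE (negPf xs).
      by rewrite setUS // setU1K.
    apply/subsetP => y; rewrite !inE => /andP[yx]; rewrite (negPf yx) /= => yC.
    have := subsetP sC y; rewrite !inE yC (negPf yx) orbT; exact.
  move=> sC; rewrite setU11 /=; congr (F (_ :: _) _); apply: eq_in_filter => y ys;
    by rewrite in_setU1; case: eqP xs ys => // -> /negPf ->.
apply: eq_big => C.
  rewrite set_cons; apply/idP/andP => [sC|[sC xC]].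
    split; first exact: subset_trans (subsetUr _ _).
    by apply/negP => /(subsetP sC); rewrite inE (negPf xs).
  by apply/subsetP => y yC; have := subsetP sC y yC; rewrite in_setU1;
    case: eqP xC yC => // -> /negPf ->.
by move=> sC; case: ifP => // xC; have := subsetP sC x xC; rewrite inE (negPf xs).
Qed.

Lemma big_splits_enum (M : nmodType) (F : seq I -> seq I -> M) A :
  \sum_(q <- splits (enum A)) F q.1 q.2 =
  \sum_(C : {set I} | C \subset A) F (enum C) (enum (A :\: C)).
Proof.
rewrite big_splits_filter ?enum_uniq //.
have -> : [set y in enum A] = A by apply/setP => y; rewrite inE mem_enum.
apply: eq_bigr => C sC.
rewrite /enum_mem -!filter_predI.
by congr (F _ _); apply: eq_filter => y; rewrite !inE;
  case: (boolP (y \in C)) => //= /(subsetP sC) ->.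
Qed.

(** [admissible] without its cardinality condition, relative to [A] so that removing a block leaves
    an object of the same kind. *)
Definition blocks A p (B : {ffun 'I_p -> {set I}}) : bool :=
  [forall i, forall j, (i != j) ==> [disjoint B i & B j]] && (\bigcup_i B i == A).

(** The position is a parameter: [brhd_subword] inserts the first block, the theorem the last. *)
Definition insert_block p (i : 'I_p.+1) C (B : {ffun 'I_p -> {set I}}) :
    {ffun 'I_p.+1 -> {set I}} :=
  [ffun j => if unlift i j is Some j' then B j' else C].

Lemma insert_block_at p i C (B : {ffun 'I_p -> {set I}}) :
  insert_block i C B i = C.
Proof. by rewrite ffunE unlift_none. Qed.

Lemma insert_block_lift p i C (B : {ffun 'I_p -> {set I}}) j :
  insert_block i C B (lift i j) = B j.
Proof. by rewrite ffunE liftK. Qed.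

Lemma blocks_insert A p (i : 'I_p.+1) C (B : {ffun 'I_p -> {set I}}) :
  blocks A (insert_block i C B) = (C \subset A) && blocks (A :\: C) B.
Proof.
rewrite /blocks (bigD1_ord i) //= insert_block_at.
under eq_bigr do rewrite insert_block_lift.
set U := \bigcup_j B j.
have CU : [forall j, [disjoint C & B j]] = [disjoint C & U].
  apply/forallP/idP => [dB|/bigcup_disjointP dB j]; last exact: dB.
  exact/bigcup_disjointP.
have -> : [forall j, forall j', (j != j') ==>
      [disjoint insert_block i C B j & insert_block i C B j']] =
    [disjoint C & U] && [forall j, forall j', (j != j') ==> [disjoint B j & B j']].
  rewrite -CU; apply/idP/andP.
    move=> /forallP dB; split; apply/forallP => j.
      have /forallP/(_ (lift i j)) := dB i.
      by rewrite neq_lift insert_block_at insert_block_lift.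
    apply/forallP => j'; have /forallP/(_ (lift i j')) := dB (lift i j).
    by rewrite (inj_eq lift_inj) !insert_block_lift.
  case=> /forallP dC /forallP dB; apply/forallP => j; apply/forallP => j'.
  case: (unliftP i j) => [l ->|->]; case: (unliftP i j') => [l' ->|->].
  - by rewrite (inj_eq lift_inj) !insert_block_lift; have /forallP := dB l.
  - by rewrite insert_block_at insert_block_lift disjoint_sym dC implybT.
  - by rewrite insert_block_at insert_block_lift dC implybT.
  - by rewrite eqxx.
case: [forall j, _]; rewrite ?andbF //= andbT.
(* What remains: [C] and [U] are disjoint with union [A] exactly when [C] lies in [A] and [U] is its
   complement there. *)
apply/andP/andP => [[dCU /eqP <-]|[CA /eqP ->]].
  rewrite disjoint_sym in dCU.
  by rewrite subsetUl setDUl setDv set0U (setDidPl dCU).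
by rewrite disjoints_subset setCD subsetUr -{1}(setIidPr CA) setID.
Qed.

Lemma big_blocks_insert (M : nmodType) A p (i : 'I_p.+1) (Q : pred {set I})
    (F : {ffun 'I_p.+1 -> {set I}} -> M) :
  \sum_(B : {ffun 'I_p.+1 -> {set I}} | blocks A B && Q (B i)) F B =
  \sum_(C : {set I} | (C \subset A) && Q C)
    \sum_(B : {ffun 'I_p -> {set I}} | blocks (A :\: C) B)
       F (insert_block i C B).
Proof.
rewrite pair_big_dep /=.
pose h (q : {set I} * {ffun 'I_p -> {set I}}) := insert_block i q.1 q.2.
pose g (B : {ffun 'I_p.+1 -> {set I}}) := (B i, [ffun j => B (lift i j)]).
have gK : cancel g h.
  move=> B; apply/ffunP => j; case: (unliftP i j) => [l ->|->].
    by rewrite insert_block_lift ffunE.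
  by rewrite insert_block_at.
have hK : cancel h g.
  move=> [C B]; rewrite /g /h insert_block_at; congr (_, _).
  by apply/ffunP => j; rewrite ffunE insert_block_lift.
rewrite (reindex h) /=; last by exists g => ? _; [apply: hK | apply: gK].
by apply: eq_bigl => -[C B]; rewrite blocks_insert insert_block_at andbAC.
Qed.

Lemma blocks0 A (B : {ffun 'I_0 -> {set I}}) : blocks A B = (A == set0).
Proof.
rewrite /blocks big_ord0 eq_sym; case: eqP => _; rewrite ?andbF ?andbT //.
by apply/forallP => -[].
Qed.

End Blocks.

(** * From splittings of words to sets of positions *)

Section SubwordSums.
Variables (k : fieldType) (V : lmodType k) (m : nat) (x : m.-tuple V).
Implicit Types A C : {set 'I_m}.

(** Letters of [x] may repeat, so the positions are split first and then mapped to letters. *)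
Lemma big_splits_subword (M : nmodType) (F : seq V -> seq V -> M) A :
  \sum_(q <- splits (subword x A)) F q.1 q.2 =
  \sum_(C : {set 'I_m} | C \subset A) F (subword x C) (subword x (A :\: C)).
Proof.
rewrite /subword splits_map big_map.
exact: (big_splits_enum (fun u v => F (map (tnth x) u) (map (tnth x) v))).
Qed.

Lemma subwordT : subword x [set: 'I_m] = x.
Proof. by rewrite /subword enum_setT -enumT map_tnth_enum. Qed.

Variables (mag : {bilinear V -> V -> V}) (S : {linear tensalg V -> tensalg V}).
Hypothesis S_antipode : is_antipode mag S.
Local Notation brhd := (brhd mag S).

(** Iterates [brhd_letterM]: the left half of each split is the block acting on the current
    letter. *)
Lemma brhd_subword (p : nat) (a : seq V) A : size a = p ->
  brhd (word (subword x A)) (word a) =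
  \sum_(B : {ffun 'I_p -> {set 'I_m}} | blocks A B)
    \prod_(j < p) brhd (word (subword x (B j))) (letter a`_j).
Proof.
elim: p a A => [|p IH] [|y a] A //=.
  rewrite word0 (brhd1 S_antipode) => _.
  under eq_big do [rewrite blocks0 | rewrite big_ord0].
  have -> : nilp (subword x A) = (A == set0).
    by rewrite /nilp size_map -cardE cards_eq0.
  case: eqP => _; last by rewrite big_pred0_eq.
  (* There is a single function on ['I_0], and its empty product is 1. *)
  rewrite (big_pred1 [ffun=> set0]) // => B.
  by apply/esym/eqP/ffunP => -[].
case=> sz_a; rewrite word_cons (brhd_letterM S_antipode).
rewrite (big_splits_subword (fun u v => brhd (word u) (letter y) * brhd (word v) (word a))).
under [RHS]eq_bigl do rewrite -[blocks _ _]andbT.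
rewrite (big_blocks_insert _ ord0 xpredT); apply: eq_big => C; rewrite ?andbT // => _.
rewrite (IH a) // mulr_sumr; apply: eq_bigr => B _.
rewrite big_ord_recl insert_block_at; congr (_ * _); apply: eq_bigr => j _.
by rewrite insert_block_lift.
Qed.

End SubwordSums.

(* The length p+1 of an admissible tuple is at most m+1, since its last block
   is a subset of [m] with p elements. *)
Theorem proposition2p11 (k : closedFieldType) (char0 : [pchar k] =i pred0)
    (V : lmodType k) (mag : {bilinear V -> V -> V})
    (S : {linear tensalg V -> tensalg V}) (S_antipode : is_antipode mag S)
    (m : nat) (x : m.-tuple V) :
  S (word x) =
    (-1) ^+ m *: \sum_(p < m.+1)
                   \sum_(B : {ffun 'I_p.+1 -> {set 'I_m}} | admissible B)
                     partition_term x mag S B.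
Proof.
rewrite (antipode_word_brhd S_antipode) size_tuple; congr (_ *: _).
rewrite -[in LHS](subwordT x).
rewrite (big_splits_subword x (fun u v => brhd mag S (word u) (word (rev v)))).
(* The sum now runs over the complement of the left half, which becomes the last block. *)
rewrite (reindex_inj (@setC_inj 'I_m)) /=.
(* Sorted by cardinality; [inord] loses nothing because a subset of ['I_m] has at most [m]
   elements. *)
rewrite (partition_big (fun J : {set 'I_m} => inord #|J| : 'I_m.+1) xpredT) //=.
apply: eq_bigr => p _.
under [RHS]eq_bigl => B do rewrite /admissible andbA -/(blocks _ B).
rewrite (big_blocks_insert [set: 'I_m] ord_max (fun J => #|J| == p)).
have cardJ (J : {set 'I_m}) : (inord #|J| == p :> 'I_m.+1) = (#|J| == p :> nat).
  by rewrite -val_eqE /= inordK // ltnS -[m in (_ <= m)%N]card_ord max_card.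
apply: eq_big => J; first by rewrite cardJ !subsetT.
rewrite cardJ !setTD setCK => /andP[_ /eqP cJ].
rewrite (@brhd_subword k V m x mag S S_antipode p); last first.
  by rewrite size_rev size_map -cardE cJ.
apply: eq_bigr => B _; apply: eq_bigr => j _.
have -> : widen_ord (leqnSn p) j = lift ord_max j.
  exact/val_inj/esym/lift_max.
by rewrite insert_block_lift insert_block_at.
Qed.
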